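(* Let $n\ge4$. Then in $H_n(q)$ $$\mathscr{Y}_{n,1}\mathscr{Y}_{n,2}-\mathscr{Y}_{n,2}\mathscr{Y}_{n,1}=\sum_{i=1}^{n-3}\bigl(T_{i+2}T_iT_{i+1}-T_{i+1}T_iT_{i+2}\bigr).$$ In particular, $\mathscr{Y}_{n,1}$ and $\mathscr{Y}_{n,2}$ do not commute.
   Context: Let $q$ be an indeterminate. $H_n(q)$ is the unital associative $\mathbb{C}(q)$-algebra generated by $T_1,\dots,T_{n-1}$ with relations $T_i^2=(q-1)T_i+q$ for $1\le i\le n-1$, $T_iT_j=T_jT_i$ for $|i-j|\ge2$, and $T_iT_{i+1}T_i=T_{i+1}T_iT_{i+1}$ for $1\le i\le n-2$. Let $\mathfrak{S}_n$ be the symmetric group with simple transpositions $s_i=(i,i+1)$ and Coxeter length $\ell$. For $w\in\mathfrak{S}_n$ with reduced expression $w=s_{i_1}\cdots s_{i_k}$ put $T_w=T_{i_1}\cdots T_{i_k}$ (with $T_e=1$); this is independent of the reduced expression and $\{T_w : w\in\mathfrak{S}_n\}$ is a $\mathbb{C}(q)$-basis of $H_n(q)$. For $0\le k\le\binom n2$ put $\mathscr{Y}_{n,k}=\sum_{w\in\mathfrak{S}_n,\ \ell(w)=k}T_w$. *)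

(* Defs.v *)
From HB Require Import structures.
From mathcomp Require Import all_boot all_order all_fingroup all_algebra.
From mathcomp Require Import boolp reals complex.
From mathcomp Require Import monalg generic_quotient.

Set Implicit Arguments.
Unset Strict Implicit.
Unset Printing Implicit Defensive.

Import GRing.Theory.
Local Open Scope ring_scope.
Local Open Scope quotient_scope.

(* C(q), where C is complex R for R the field of real numbers. *)
Definition ratfun (R : realType) := {fraction {poly complex R}}.
HB.instance Definition _ (R : realType) := GRing.Field.on (ratfun R).

Definition qvar (R : realType) : ratfun R := tofrac 'X.

(* The free unital associative K-algebra on I, i.e. the algebra of the free
   monoid on I. The alias is needed because the algType instance of {malg _}
   in the library is reserved for commutative monoids. *)
Definition free_alg (K : fieldType) (I : choiceType) : Type :=
  {malg K[{fmonom I}]}.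

Section FreeAlgebra.
Variables (K : fieldType) (I : choiceType).

HB.instance Definition _ :=
  GRing.Lalgebra.copy (free_alg K I) {malg K[{fmonom I}]}.

Lemma free_alg_scalerAr (k : K) (x y : free_alg K I) :
  k *: (x * y) = x * (k *: y).
Proof.
apply/malgP => m; rewrite mcoeffZ.
rewrite (@mcoeffMlw _ _ (msupp x) (msupp y) x (k *: y)) ?finmap.fsubset_refl //;
  last exact: msuppZ_le.
rewrite mcoeffMl mulr_sumr; apply: eq_bigr => k1 _.
rewrite mulr_sumr; apply: eq_bigr => k2 _.
by rewrite mcoeffZ mulrCA mulrnAr.
Qed.

HB.instance Definition _ :=
  GRing.Lalgebra_isAlgebra.Build K (free_alg K I) free_alg_scalerAr.

Definition free_gen (i : I) : free_alg K I := << fmu i >>.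

Section FreeLift.
Variables (A : algType K) (x : I -> A).

Definition word_prod (w : {fmonom I}) : A := \prod_(i <- (w : seq I)) x i.

Lemma word_prod_mmorphism : mmorphism word_prod.
Proof.
split=> [u v|]; last by rewrite /word_prod fm1 big_nil.
by rewrite /word_prod fmM big_cat.
Qed.
HB.instance Definition _ :=
  monalg.isMultiplicative.Build _ _ word_prod word_prod_mmorphism.

Definition free_lift (u : free_alg K I) : A := mmap (in_alg A) word_prod u.

Lemma free_lift_is_zmod_morphism : zmod_morphism free_lift.
Proof. by move=> u v; rewrite /free_lift raddfB. Qed.

Lemma free_lift_is_monoid_morphism : monoid_morphism free_lift.
Proof.
have [] // := @commr_mmap_is_multiplicative _ _ _ (in_alg A) word_prod _.
by move=> g m m'; rewrite /GRing.comm /= -scalerAl -scalerAr mul1r mulr1.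
Qed.

Lemma free_lift_is_scalable : scalable free_lift.
Proof. by move=> k u; rewrite /free_lift mmapZ mulr_algl. Qed.

HB.instance Definition _ := GRing.isZmodMorphism.Build _ _ free_lift
  free_lift_is_zmod_morphism.
HB.instance Definition _ := GRing.isMonoidMorphism.Build _ _ free_lift
  free_lift_is_monoid_morphism.
HB.instance Definition _ := GRing.isScalable.Build K _ _ *:%R free_lift
  free_lift_is_scalable.

Lemma free_lift_gen i : free_lift (free_gen i) = x i.
Proof.
by rewrite /free_lift /free_gen mmapU /word_prod fmU big_seq1 /= scale1r mul1r.
Qed.

End FreeLift.

End FreeAlgebra.

Section TwoSidedIdeal.
Variable A : nzRingType.

Definition two_sided_ideal (J : A -> Prop) : Prop :=
  [/\ J 0,
      forall x y, J x -> J y -> J (x - y),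
      forall a x, J x -> J (a * x)
    & forall a x, J x -> J (x * a)].

Variable X : A -> Prop.

Definition generated_ideal : {pred A} := fun x =>
  `[< forall J : A -> Prop, two_sided_ideal J ->
        (forall r, X r -> J r) -> J x >].

Lemma generated_idealP x :
  reflect (forall J : A -> Prop, two_sided_ideal J ->
             (forall r, X r -> J r) -> J x)
          (x \in generated_ideal).
Proof. exact: asboolP. Qed.

Lemma mem_generated_ideal r : X r -> r \in generated_ideal.
Proof. by move=> Xr; apply/generated_idealP => J _; apply. Qed.

Lemma generated_ideal_zmod_closed : zmod_closed generated_ideal.
Proof.
split=> [|x y /generated_idealP Jx /generated_idealP Jy].
  by apply/generated_idealP => J [].
apply/generated_idealP => J idJ XJ; have [_ JB _ _] := idJ.
by apply: JB; [exact: Jx | exact: Jy].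
Qed.

HB.instance Definition _ :=
  GRing.isZmodClosed.Build A generated_ideal generated_ideal_zmod_closed.

Lemma generated_idealMl a x : x \in generated_ideal -> a * x \in generated_ideal.
Proof.
move=> /generated_idealP Jx; apply/generated_idealP => J idJ XJ.
by have [_ _ JM _] := idJ; apply: JM; exact: Jx.
Qed.

Lemma generated_idealMr a x : x \in generated_ideal -> x * a \in generated_ideal.
Proof.
move=> /generated_idealP Jx; apply/generated_idealP => J idJ XJ.
by have [_ _ _ JM] := idJ; apply: JM; exact: Jx.
Qed.

Lemma generated_ideal_proper (B : nzRingType) (f : {rmorphism A -> B}) :
  (forall r, X r -> f r = 0) -> 1 \notin generated_ideal.
Proof.
move=> fX; apply/negP => /generated_idealP /(_ (fun y => f y = 0)).
rewrite rmorph1 => H; suff /eqP : (1 : B) = 0 by rewrite oner_eq0.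
apply: H => //; split=> [|y z Hy Hz|a y Hy|a y Hy].
- by rewrite rmorph0.
- by rewrite rmorphB Hy Hz subrr.
- by rewrite rmorphM Hy mulr0.
- by rewrite rmorphM Hy mul0r.
Qed.

End TwoSidedIdeal.

(* The quotient of A by the two-sided ideal generated by X. Properness is needed
   because algType excludes the zero ring. *)
Section QuotientAlgebra.
Variables (K : fieldType) (A : algType K) (X : A -> Prop).
Hypothesis properX : 1 \notin generated_ideal X.

Definition quot_alg of 1 \notin generated_ideal X : Type :=
  Quotient.quot (generated_ideal X).

Local Notation Q := (quot_alg properX).

HB.instance Definition _ := GRing.Zmodule.on Q.
HB.instance Definition _ := EqQuotient.on Q.

Local Notation proj := (\pi_Q : A -> Q).

Lemma quot_algP (u v : A) :
  reflect (u = v %[mod Q]) (u - v \in (generated_ideal X)).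
Proof. by rewrite Quotient.idealrBE; exact: eqP. Qed.

Definition quot_one : Q := proj 1.
Definition quot_mul (a b : Q) : Q := proj (repr a * repr b).
Definition quot_scale (k : K) (a : Q) : Q := proj (k *: repr a).

Lemma proj_surj (a : Q) : exists u, a = proj u.
Proof. by exists (repr a); rewrite reprK. Qed.

Lemma repr_sub (u : A) : repr (proj u) - u \in (generated_ideal X).
Proof. by apply/quot_algP; rewrite reprK. Qed.

Lemma pi_add : {morph proj : u v / u + v}.
Proof. exact: Quotient.pi_add. Qed.

Lemma pi_zero : proj 0 = 0.
Proof. by apply: (addrI (proj 0)); rewrite -pi_add !addr0. Qed.

Lemma pi_mul (u v : A) : quot_mul (proj u) (proj v) = proj (u * v).
Proof.
apply/quot_algP.
rewrite -[X in X - _](subrK (u * repr (proj v))) -mulrBl -addrA -mulrBr.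
rewrite rpredD //; first by apply: generated_idealMr; exact: repr_sub.
by apply: generated_idealMl; exact: repr_sub.
Qed.

Lemma pi_scale k (u : A) : quot_scale k (proj u) = proj (k *: u).
Proof.
apply/quot_algP; rewrite -scalerBr -[X in _ *: X]mul1r scalerAl.
by apply: generated_idealMl; exact: repr_sub.
Qed.

Lemma quot_mulA : associative quot_mul.
Proof.
move=> a b c.
case: (proj_surj a) (proj_surj b) (proj_surj c) => [u ->] [v ->] [w ->].
by rewrite !pi_mul mulrA.
Qed.

Lemma quot_mul1 : left_id quot_one quot_mul.
Proof. by move=> a; have [u ->] := proj_surj a; rewrite pi_mul mul1r. Qed.

Lemma quot_mulr1 : right_id quot_one quot_mul.
Proof. by move=> a; have [u ->] := proj_surj a; rewrite pi_mul mulr1. Qed.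

Lemma quot_mulDl : left_distributive quot_mul +%R.
Proof.
move=> a b c.
case: (proj_surj a) (proj_surj b) (proj_surj c) => [u ->] [v ->] [w ->].
by rewrite -pi_add !pi_mul -pi_add mulrDl.
Qed.

Lemma quot_mulDr : right_distributive quot_mul +%R.
Proof.
move=> a b c.
case: (proj_surj a) (proj_surj b) (proj_surj c) => [u ->] [v ->] [w ->].
by rewrite -pi_add !pi_mul -pi_add mulrDr.
Qed.

Lemma quot_one_neq0 : quot_one != 0.
Proof.
apply/eqP => H; move: properX; rewrite -[1]subr0.
by move/quot_algP; apply; rewrite -/quot_one H pi_zero.
Qed.

HB.instance Definition _ := GRing.Zmodule_isNzRing.Build Q
  quot_mulA quot_mul1 quot_mulr1 quot_mulDl quot_mulDr quot_one_neq0.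

Lemma quot_scaleA k l (a : Q) :
  quot_scale k (quot_scale l a) = quot_scale (k * l) a.
Proof. by have [u ->] := proj_surj a; rewrite !pi_scale scalerA. Qed.

Lemma quot_scale1 : left_id 1 quot_scale.
Proof. by move=> a; have [u ->] := proj_surj a; rewrite pi_scale scale1r. Qed.

Lemma quot_scaleDr : right_distributive quot_scale +%R.
Proof.
move=> k a b; case: (proj_surj a) (proj_surj b) => [u ->] [v ->].
by rewrite -pi_add !pi_scale -pi_add scalerDr.
Qed.

Lemma quot_scaleDl (a : Q) : {morph quot_scale^~ a : k l / k + l}.
Proof.
by move=> k l; have [u ->] := proj_surj a; rewrite !pi_scale -pi_add scalerDl.
Qed.

HB.instance Definition _ := GRing.Zmodule_isLmodule.Build K Q
  quot_scaleA quot_scale1 quot_scaleDr quot_scaleDl.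

Lemma quot_scaleAl k (a b : Q) : k *: (a * b) = (k *: a) * b.
Proof.
case: (proj_surj a) (proj_surj b) => [u ->] [v ->].
rewrite [_ * _]pi_mul [LHS]pi_scale.
by rewrite [_ *: \pi_Q _]pi_scale [RHS]pi_mul scalerAl.
Qed.

HB.instance Definition _ := GRing.Lmodule_isLalgebra.Build K Q quot_scaleAl.

Lemma quot_scaleAr k (a b : Q) : k *: (a * b) = a * (k *: b).
Proof.
case: (proj_surj a) (proj_surj b) => [u ->] [v ->].
rewrite [_ * _]pi_mul [LHS]pi_scale.
by rewrite [_ *: \pi_Q _]pi_scale [RHS]pi_mul scalerAr.
Qed.

HB.instance Definition _ := GRing.Lalgebra_isAlgebra.Build K Q quot_scaleAr.

Definition quot_proj (u : A) : Q := proj u.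

Lemma quot_projP u v :
  reflect (quot_proj u = quot_proj v) (u - v \in generated_ideal X).
Proof. exact: quot_algP. Qed.

Lemma quot_proj_is_zmod_morphism : zmod_morphism quot_proj.
Proof.
move=> u v; apply: (addIr (quot_proj v)).
by rewrite subrK /quot_proj -pi_add subrK.
Qed.

Lemma quot_proj_is_monoid_morphism : monoid_morphism quot_proj.
Proof. by split=> // u v; rewrite [RHS]pi_mul. Qed.

Lemma quot_proj_is_scalable : scalable quot_proj.
Proof. by move=> k u; rewrite [RHS]pi_scale. Qed.

HB.instance Definition _ :=
  GRing.isZmodMorphism.Build A Q quot_proj quot_proj_is_zmod_morphism.
HB.instance Definition _ :=
  GRing.isMonoidMorphism.Build A Q quot_proj quot_proj_is_monoid_morphism.
HB.instance Definition _ :=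
  GRing.isScalable.Build K A Q *:%R quot_proj quot_proj_is_scalable.

Lemma quot_proj_eq0 r : X r -> quot_proj r = 0.
Proof.
move=> Xr; rewrite -(raddf0 quot_proj); apply/quot_projP.
by rewrite subr0; exact: mem_generated_ideal.
Qed.

End QuotientAlgebra.

(* The generators T_1, ..., T_(n-1) are indexed from 0: i : 'I_n.-1 stands for
   T_(i+1), and likewise for the simple transpositions below. *)
Section Hecke.
Variables (K : fieldType) (q : K) (n : nat).

Variant hecke_relator (A : algType K) (x : 'I_n.-1 -> A) : A -> Prop :=
| HeckeQuadratic i :
    hecke_relator x (x i * x i - ((q - 1) *: x i + q%:A))
| HeckeCommute (i j : 'I_n.-1) of (i.+1 < j)%N || (j.+1 < i)%N :
    hecke_relator x (x i * x j - x j * x i)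
| HeckeBraid (i j : 'I_n.-1) of j = i.+1 :> nat :
    hecke_relator x (x i * x j * x i - x j * x i * x j).

Lemma hecke_relator_index (A : algType K) (x : 'I_n.-1 -> A)
    (f : {lrmorphism A -> K^o}) : (forall i, f (x i) = q) ->
  forall r, hecke_relator x r -> f r = 0.
Proof.
have fZ k u : f (k *: u) = k * f u by rewrite linearZ.
move=> fx _ [i|i j _|i j _].
- rewrite rmorphB rmorphM rmorphD /= !fZ rmorph1 fx mulr1.
  by rewrite [(q - 1) * q]mulrBl mul1r subrK subrr.
- by rewrite rmorphB !rmorphM /= !fx subrr.
- by rewrite rmorphB !rmorphM /= !fx subrr.
Qed.

(* The relators vanish under T_i |-> q, so H_n(q) is not the zero ring. *)
Lemma hecke_ideal_proper :
  1 \notin generated_ideal (hecke_relator (@free_gen K 'I_n.-1)).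
Proof.
pose f : {lrmorphism _ -> _} := @free_lift K _ K^o (fun _ : 'I_n.-1 => q).
apply: (@generated_ideal_proper _ _ _ f).
by apply: hecke_relator_index => i; exact: free_lift_gen.
Qed.

Lemma hecke_relations (A B : algType K) (f : {lrmorphism A -> B})
    (x : 'I_n.-1 -> A) : (forall r, hecke_relator x r -> f r = 0) ->
  [/\ forall i, f (x i) * f (x i) = (q - 1) *: f (x i) + q%:A,
      forall i j : 'I_n.-1, (i.+1 < j)%N || (j.+1 < i)%N ->
        f (x i) * f (x j) = f (x j) * f (x i)
    & forall i j : 'I_n.-1, j = i.+1 :> nat ->
        f (x i) * f (x j) * f (x i) = f (x j) * f (x i) * f (x j)].
Proof.
move=> f0; have fZ k u : f (k *: u) = k *: f u by rewrite linearZ.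
split=> [i|i j ij|i j ij]; apply/eqP; rewrite -subr_eq0.
- rewrite -[X in _ == X](f0 _ (HeckeQuadratic x i)).
  by rewrite rmorphB rmorphM rmorphD /= !fZ rmorph1.
- by rewrite -[X in _ == X](f0 _ (HeckeCommute x ij)) rmorphB !rmorphM.
- by rewrite -[X in _ == X](f0 _ (HeckeBraid x ij)) rmorphB !rmorphM.
Qed.

Definition hecke : algType K := quot_alg hecke_ideal_proper.

Definition hecke_gen (i : 'I_n.-1) : hecke :=
  quot_proj hecke_ideal_proper (free_gen K i).

Lemma hecke_gen_relations :
  [/\ forall i, hecke_gen i * hecke_gen i = (q - 1) *: hecke_gen i + q%:A,
      forall i j : 'I_n.-1, (i.+1 < j)%N || (j.+1 < i)%N ->
        hecke_gen i * hecke_gen j = hecke_gen j * hecke_gen i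
    & forall i j : 'I_n.-1, j = i.+1 :> nat ->
        hecke_gen i * hecke_gen j * hecke_gen i
        = hecke_gen j * hecke_gen i * hecke_gen j].
Proof.
apply: (@hecke_relations _ hecke (quot_proj hecke_ideal_proper)) => r.
exact: quot_proj_eq0.
Qed.

(* T_i for i : nat indexed from 1 as usual, with junk value 0 unless
   1 <= i <= n - 1. *)
Definition hecke_T (i : nat) : hecke :=
  if [pick j : 'I_n.-1 | j.+1 == i] is Some j then hecke_gen j else 0.

End Hecke.

Section Coxeter.
Variable n : nat.
Implicit Types (w : 'S_n) (e : seq 'I_n.-1).

Lemma simple_lo_subproof (i : 'I_n.-1) : (i < n)%N.
Proof. exact: leq_trans (ltn_ord i) (leq_pred n). Qed.

Lemma simple_hi_subproof (i : 'I_n.-1) : (i.+1 < n)%N.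
Proof. by rewrite -ltn_predRL. Qed.

Definition simple_transp (i : 'I_n.-1) : 'S_n :=
  tperm (Ordinal (simple_lo_subproof i)) (Ordinal (simple_hi_subproof i)).

(* In {perm _} the product s * t applies s first. The opposite convention
   replaces w by w^-1, which changes neither lengths nor the sums hecke_Y. *)
Definition expresses e w : bool := (\prod_(i <- e) simple_transp i)%g == w.

Lemma tperm_expressed d (a b : 'I_n) :
  b = (a + d.+1)%N :> nat -> exists e, expresses e (tperm a b).
Proof.
elim: d a b => [|d IHd] a b ab.
  have lt_a : (a < n.-1)%N.
    by rewrite ltn_predRL; move: (ltn_ord b); rewrite ab addn1.
  exists [:: Ordinal lt_a]; rewrite /expresses big_seq1; apply/eqP.
  by congr tperm; apply: val_inj; rewrite //= ab addn1.
have lt_c : (a + d.+1 < n)%N by rewrite -addnS -ab ltnW.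
have lt_c1 : (a + d.+1 < n.-1)%N by rewrite ltn_predRL -addnS -ab.
pose c := Ordinal lt_c.
have [e /eqP He] := IHd a c erefl.
exists (Ordinal lt_c1 :: e ++ [:: Ordinal lt_c1]).
rewrite /expresses big_cons big_cat big_seq1 He; apply/eqP.
have -> : simple_transp (Ordinal lt_c1) = tperm c b.
  by congr tperm; apply: val_inj; rewrite /= ?ab ?addnS.
rewrite -{1}[tperm c b]tpermV -conjgE tpermJ tpermL tpermD //.
- by rewrite -val_eqE /= gtn_eqF // addnS ltnS leq_addr.
- by rewrite -val_eqE /= ab gtn_eqF // addnS ltnS leq_addr.
Qed.

Lemma expressible w : exists e, expresses e w.
Proof.
have [ts -> _] := prod_tpermP w.
elim: ts => [|[a b] ts [e /eqP He]].
  by exists [::]; rewrite /expresses !big_nil.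
suff [e' /eqP He'] : exists e', expresses e' (tperm a b).
  by exists (e' ++ e); rewrite /expresses big_cat big_cons He He'.
case: (ltngtP a b) => [ab|ba|/val_inj ->].
- by apply: (@tperm_expressed (b - a.+1)); rewrite -subSn // subSS subnKC // ltnW.
- rewrite tpermC.
  by apply: (@tperm_expressed (a - b.+1)); rewrite -subSn // subSS subnKC // ltnW.
- by exists [::]; rewrite /expresses big_nil tperm1.
Qed.

Lemma has_expression_length w :
  exists k, [exists e : k.-tuple 'I_n.-1, expresses e w].
Proof.
have [e He] := expressible w.
by exists (size e); apply/existsP; exists (in_tuple e).
Qed.

Definition coxeter_length w : nat := ex_minn (has_expression_length w).

Definition reduced e w : bool :=
  expresses e w && (size e == coxeter_length w).

Lemma has_reduced w : exists e, reduced e w.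
Proof.
rewrite /reduced /coxeter_length; case: ex_minnP => k /existsP[e He] _.
by exists e; rewrite He size_tuple eqxx.
Qed.

Definition reduced_word w : seq 'I_n.-1 := xchoose (has_reduced w).

Lemma reduced_wordP w : reduced (reduced_word w) w.
Proof. exact: (xchooseP (has_reduced w)). Qed.

End Coxeter.

(* T_w does not depend on the reduced expression chosen for w. *)
Definition hecke_Tw (K : fieldType) (q : K) (n : nat) (w : 'S_n) : hecke q n :=
  \prod_(i <- reduced_word w) hecke_gen q i.

Definition hecke_Y (K : fieldType) (q : K) (n k : nat) : hecke q n :=
  \sum_(w : 'S_n | coxeter_length w == k) hecke_Tw q w.

(* Main.v *)
From HB Require Import structures.
Require Import Defs.
From mathcomp Require Import all_boot all_order all_fingroup all_algebra.
From mathcomp Require Import reals complex generic_quotient zify ring.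
Set Implicit Arguments.
Unset Strict Implicit.
Unset Printing Implicit Defensive.
Import GRing.Theory.
Local Open Scope ring_scope.

(* Let t_i be the generators, b_i = t_i t_(i+1) + t_(i+1) t_i and B = \sum_i b_i.
   Since s_i s_j = s_k s_l with i != j forces {i, j} = {k, l}, the elements of
   length 2 give 2 Y_2 = Y_1^2 - \sum_i t_i^2 + B; the quadratic relation makes
   \sum_i t_i^2 commute with Y_1, so 2 [Y_1, Y_2] = [Y_1, B]. In [Y_1, b_i] the
   contributions of t_i and t_(i+1) cancel by the quadratic relation, and those
   of t_(i-1) and t_(i+2) recombine into the claimed sum. The sum is nonzero
   because in the reduced Burau representation every t_i but the first
   multiplies the first basis row vector by q, so only the first summand
   contributes to the (0, 0) entry, which is q^2. *)

(** * Simple transpositions and permutations of length at most 2 *)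

Section SimpleTranspositions.
Variable n : nat.
Implicit Types (i j k l : 'I_n.-1) (w : 'S_n).
Local Notation s := (@simple_transp n).

(** The action of [simple_transp i] carried over to natural numbers, so that identities between
    products of simple transpositions become case splits for linear arithmetic. *)
Definition nat_swap (i x : nat) : nat :=
  if x == i then i.+1 else if x == i.+1 then i else x.

Lemma nat_swap_cases (i x : nat) :
  x = i /\ nat_swap i x = i.+1 \/ x = i.+1 /\ nat_swap i x = i
  \/ x <> i /\ x <> i.+1 /\ nat_swap i x = x.
Proof. by rewrite /nat_swap; case: eqP => [|?]; [|case: eqP => [|?]]; auto. Qed.

Lemma val_simple_transp i (x : 'I_n) : s i x = nat_swap i x :> nat.
Proof. by rewrite /nat_swap permE /= -!val_eqE /=; do 2?case: eqP. Qed.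

Lemma simple_transp_inj : injective s.
Proof.
move=> i j eq_ij; apply: val_inj => /=.
pose x := Ordinal (simple_lo_subproof i).
have := congr1 (fun w : 'S_n => val (w x)) eq_ij.
by rewrite /= !val_simple_transp /nat_swap /= eqxx; do !case: ifP => ?; try lia.
Qed.

Lemma odd_simple_transp i : s i :> bool.
Proof. by rewrite odd_tperm -val_eqE /= neq_ltn ltnSn. Qed.

Lemma simple_transpK i : (s i * s i = 1)%g.
Proof. exact: tperm2. Qed.

Lemma simple_transp_mul_eq1 i j : ((s i * s j)%g == 1%g) = (i == j).
Proof.
apply/eqP/eqP => [ij1|->]; last exact: simple_transpK.
apply: simple_transp_inj.
by rewrite -[LHS]mulg1 -(simple_transpK j) mulgA ij1 mul1g.
Qed.

Lemma simple_transp_commute i j : (i.+1 < j)%N || (j.+1 < i)%N ->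
  (s i * s j = s j * s i)%g.
Proof.
move=> ij; apply/permP => x; apply: val_inj => /=.
rewrite !permM !val_simple_transp.
have := nat_swap_cases i x; have := nat_swap_cases j x.
have := nat_swap_cases j (nat_swap i x).
by have := nat_swap_cases i (nat_swap j x); lia.
Qed.

(* The left descents k of w are the k with w (k + 1) < w k. *)
Lemma descent_mul_simple i j k : i != j ->
  ((s i * s j)%g (Ordinal (simple_hi_subproof k))
     < (s i * s j)%g (Ordinal (simple_lo_subproof k)))%N
  = (k == i) || (k == j) && ((i.+1 < j)%N || (j.+1 < i)%N).
Proof.
rewrite -!val_eqE !permM !val_simple_transp /=.
have := nat_swap_cases i k; have := nat_swap_cases i k.+1.
have := nat_swap_cases j (nat_swap i k).
by have := nat_swap_cases j (nat_swap i k.+1); lia.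
Qed.

(** Since [k] is a left descent of [s k * s l], it is one of [s i * s j], hence equals [i], or
    equals [j] with [i] and [j] distant. Cancelling the first factor then determines [l]. *)
Lemma simple_mul_eq i j k l : i != j -> (s i * s j = s k * s l)%g ->
  (k, l) = (i, j) \/ (k, l) = (j, i) /\ ((i.+1 < j)%N || (j.+1 < i)%N).
Proof.
move=> ij eqw.
have kl : k != l by rewrite -simple_transp_mul_eq1 -eqw simple_transp_mul_eq1.
have := descent_mul_simple k kl; rewrite -eqw descent_mul_simple // eqxx /=.
case/orP=> [/eqP ki|/andP[/eqP kj far]].
  by move: eqw; rewrite ki => /mulgI/simple_transp_inj ->; left.
move: eqw; rewrite simple_transp_commute // kj => /mulgI/simple_transp_inj <-.
by right.
Qed.

Lemma coxeter_length_le (e : seq 'I_n.-1) w :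
  expresses e w -> (coxeter_length w <= size e)%N.
Proof.
move=> ew; rewrite /coxeter_length; case: ex_minnP => m _; apply.
by apply/existsP; exists (in_tuple e).
Qed.

Lemma reduced_word_size w : size (reduced_word w) = coxeter_length w.
Proof. by have /andP[_ /eqP] := reduced_wordP w. Qed.

Lemma prod_reduced_word w : (\prod_(i <- reduced_word w) s i)%g = w.
Proof. by have /andP[/eqP] := reduced_wordP w. Qed.

Lemma coxeter_length_eq0 w : (coxeter_length w == 0)%N = (w == 1%g).
Proof.
apply/idP/eqP => [|->].
  rewrite -reduced_word_size size_eq0 => /eqP w0.
  by rewrite -(prod_reduced_word w) w0 big_nil.
by rewrite -leqn0 (@coxeter_length_le [::]) // /expresses big_nil.
Qed.

Lemma coxeter_length_simple i : coxeter_length (s i) = 1%N.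
Proof.
apply/eqP; rewrite eqn_leq lt0n coxeter_length_eq0.
rewrite (@coxeter_length_le [:: i]) /expresses ?big_seq1 //=.
(* The sign rules out length 0. *)
by apply: contraTneq (odd_simple_transp i) => ->; rewrite odd_perm1.
Qed.

Lemma coxeter_length1P w :
  reflect (exists i, w = s i) (coxeter_length w == 1%N).
Proof.
apply: (iffP eqP) => [w1|[i ->]]; last exact: coxeter_length_simple.
move: (reduced_word_size w) (prod_reduced_word w); rewrite w1.
by case: reduced_word => [|i []] // _; rewrite big_seq1 => <-; exists i.
Qed.

Lemma coxeter_length_simple_mul i j :
  i != j -> coxeter_length (s i * s j)%g = 2.
Proof.
move=> ij; have : (coxeter_length (s i * s j)%g <= 2)%N.
  by rewrite (@coxeter_length_le [:: i; j]) // /expresses big_cons big_seq1.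
rewrite leq_eqVlt => /orP[/eqP //|]; rewrite ltnS leq_eqVlt ltnS leqn0.
rewrite coxeter_length_eq0 simple_transp_mul_eq1 (negPf ij) orbF.
(* Length 1 is excluded by parity: a product of two transpositions is even. *)
case/coxeter_length1P=> k /(congr1 (@odd_perm _)).
by rewrite odd_permM !odd_simple_transp.
Qed.

Lemma reduced_word_length2 w : coxeter_length w = 2 ->
  exists i j, [/\ i != j, w = (s i * s j)%g & reduced_word w = [:: i; j]].
Proof.
move=> w2; move: (reduced_word_size w) (prod_reduced_word w); rewrite w2.
case: reduced_word => [|i [|j []]] // _; rewrite big_cons big_seq1 => wE.
exists i, j; split=> //; rewrite -simple_transp_mul_eq1 wE.
by rewrite -coxeter_length_eq0 w2.
Qed.

End SimpleTranspositions.

(** * Commutator calculus in a ring *)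

Section Commutators.
Variable A : pzRingType.
Implicit Types x y z : A.

Definition bracket x y : A := x * y - y * x.

Lemma bracket0 x : bracket x 0 = 0.
Proof. by rewrite /bracket mulr0 mul0r subr0. Qed.

Lemma bracketxx x : bracket x x = 0.
Proof. exact: subrr. Qed.

Lemma bracketDl x y z : bracket (x + y) z = bracket x z + bracket y z.
Proof. by rewrite /bracket mulrDl mulrDr opprD addrACA. Qed.

Lemma bracketDr x y z : bracket x (y + z) = bracket x y + bracket x z.
Proof. by rewrite /bracket mulrDl mulrDr opprD addrACA. Qed.

Lemma bracketMnr x y k : bracket x (y *+ k) = bracket x y *+ k.
Proof. by rewrite /bracket mulrnAr mulrnAl mulrnBl. Qed.

Lemma bracketMr x y z : bracket x (y * z) = bracket x y * z + y * bracket x z.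
Proof. by rewrite /bracket mulrBl mulrBr !mulrA addrA subrK. Qed.

Lemma bracket_sumr I (r : seq I) (P : pred I) (F : I -> A) x :
  (forall i, P i -> bracket x (F i) = 0) ->
  bracket x (\sum_(i <- r | P i) F i) = 0.
Proof.
move=> xF; elim/big_rec: _ => [|i y Pi xy]; first exact: bracket0.
by rewrite bracketDr xF // xy addr0.
Qed.

Lemma bracket_eq0C x y : bracket x y = 0 -> bracket y x = 0.
Proof. by rewrite /bracket => /subr0_eq ->; rewrite subrr. Qed.

End Commutators.

(** * Sums over a sequence whose distant members commute *)

Section BraidSums.
Variables (A : pzRingType) (t : nat -> A).
Hypothesis t_far : forall i j, (i.+1 < j)%N -> bracket (t i) (t j) = 0.

Definition adjacent_sum i : A := t i * t i.+1 + t i.+1 * t i.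

Lemma bracket_adjacent_sum_far i j : (i.+2 < j)%N || (j.+1 < i)%N ->
  bracket (t j) (adjacent_sum i) = 0.
Proof.
move=> ij; have far k : (k == i) || (k == i.+1) -> bracket (t j) (t k) = 0.
  move=> ki; have [kj|jk] : (k.+1 < j)%N \/ (j.+1 < k)%N by lia.
    exact/bracket_eq0C/t_far.
  exact: t_far.
by rewrite bracketDr !bracketMr !far ?eqxx ?orbT // !mul0r !mulr0 !addr0.
Qed.

(** Write a, b, c for [t i], [t i.+1], [t i.+2], so that ac = ca. Both brackets contain cab - bac,
    and their other parts, cba - abc and abc - cba, cancel. *)
Lemma bracket_adjacent_sum_next i :
  bracket (t i.+2) (adjacent_sum i) + bracket (t i) (adjacent_sum i.+1)
  = (t i.+2 * t i * t i.+1 - t i.+1 * t i * t i.+2) *+ 2.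
Proof.
have /subr0_eq ac : bracket (t i) (t i.+2) = 0 by exact: t_far.
rewrite /adjacent_sum; move: (t i) (t i.+1) (t i.+2) ac => a b c ac.
have -> : bracket c (a * b + b * a)
    = (c * a * b - b * a * c) + (c * b * a - a * b * c).
  by rewrite /bracket mulrDl mulrDr !mulrA opprD [- _ - _]addrC addrACA.
have -> : bracket a (b * c + c * b)
    = (c * a * b - c * b * a) + (a * b * c - b * a * c).
  rewrite /bracket mulrDl mulrDr !mulrA ac opprD -[b * c * a]mulrA -ac !mulrA.
  by rewrite addrACA addrC.
by rewrite addrACA subrKA -addrA subrKA.
Qed.

Hypothesis t_near :
  forall i, bracket (t i) (adjacent_sum i) + bracket (t i.+1) (adjacent_sum i) = 0.

(** Induction on [m]. Among the new brackets, those of distant indices vanish and those inside a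
    single adjacent sum cancel by [t_near]; the two that survive are combined by
    [bracket_adjacent_sum_next]. *)
Lemma bracket_sum_adjacent_sum m :
  bracket (\sum_(i < m.+1) t i) (\sum_(i < m) adjacent_sum i)
  = (\sum_(i < m.-1) (t i.+2 * t i * t i.+1 - t i.+1 * t i * t i.+2)) *+ 2.
Proof.
elim: m => [|m IHm]; first by rewrite /= !big_ord0 bracket0 mul0rn.
rewrite [X in bracket _ X]big_ord_recr bracketDr [X in bracket X _]big_ord_recr.
(* The first step stands apart: [m.-1] is 0 both before and after it, so the right-hand side gains
   no summand. *)
rewrite bracketDl {}IHm /=; case: m => [|m].
  rewrite !big_ord0 bracket0 addr0 mul0rn add0r.
  by rewrite !big_ord_recr big_ord0 /= add0r bracketDl t_near.
rewrite [in RHS]big_ord_recr mulrnDl -bracket_adjacent_sum_next /= -addrA.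
congr (_ + _); rewrite [X in bracket _ X]big_ord_recr bracketDr /=.
rewrite bracket_sumr => [|i _]; last first.
  by rewrite bracket_adjacent_sum_far //= !ltnS ltn_ord.
rewrite add0r; congr (_ + _).
rewrite !big_ord_recr /= !bracketDl -addrA t_near addr0.
rewrite (@bracket_eq0C _ _ (\sum_(i < m) t i)) ?add0r //.
apply: bracket_sumr => i _; apply/bracket_eq0C.
by rewrite bracket_adjacent_sum_far //= !ltnS ltn_ord orbT.
Qed.

(** The index set is meant to hold one pair for each permutation of length 2: both orders of
    adjacent indices, but only the increasing order of distant ones, whose transpositions
    commute. *)
Definition pair_sum m : A :=
  \sum_(j < m) \sum_(i < m | (i < j)%N || (i == j.+1 :> nat)) t i * t j.

Lemma pair_sum_recr m :
  pair_sum m.+2 = pair_sum m.+1 + t m.+1 * t m + (\sum_(i < m.+1) t i) * t m.+1.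
Proof.
rewrite /pair_sum big_ord_recr /=; congr (_ + _); last first.
  rewrite big_mkcond big_ord_recr /= ltnn ltn_eqF // addr0 mulr_suml.
  by apply: eq_bigr => i _; rewrite ltn_ord.
under eq_bigr => j _ do rewrite big_mkcond big_ord_recr -big_mkcond /=.
rewrite big_split; congr (_ + _) => /=.
rewrite big_ord_recr /= eqxx orbT big1 ?add0r // => j _.
by rewrite eqSS gtn_eqF // orbF ltnNge leqW // ltnW // ltn_ord.
Qed.

(** Doubling [pair_sum] yields every product with distinct indices once, since distant factors may
    be exchanged, plus one extra copy of each product of neighbours. These extra copies form the
    adjacent sums. *)
Lemma double_pair_sum m :
  pair_sum m.+1 *+ 2 + \sum_(i < m.+1) t i * t i
  = (\sum_(i < m.+1) t i) * (\sum_(i < m.+1) t i) + \sum_(i < m) adjacent_sum i.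
Proof.
elim: m => [|m IHm].
  rewrite /pair_sum !big_ord1 big_ord0 big_pred0 ?mul0rn ?add0r ?addr0 // => i.
  by rewrite ord1.
(* Of the two copies of the terms added by [pair_sum_recr], one is reversed, to supply the cross
   term of the square with [t m.+1] on the left. *)
have swap : t m.+1 * t m + (\sum_(i < m.+1) t i) * t m.+1
    = t m.+1 * (\sum_(i < m.+1) t i) + t m * t m.+1.
  rewrite big_ord_recr /= mulrDl mulrDr addrCA addrA; congr (_ + _ + _).
  apply/subr0_eq/bracket_eq0C/bracket_sumr => i _; apply/bracket_eq0C/t_far.
  by rewrite ltnS.
rewrite pair_sum_recr ![\sum_(i < m.+2) _]big_ord_recr /=.
rewrite [\sum_(i < m.+1) adjacent_sum i]big_ord_recr /=.
rewrite mulr2n [LHS](AC ((3*3)*2) ((1*4*7)*8*(2*3)*(5*6))) /= -mulr2n {}IHm.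
rewrite [in X in X + (_ + _)]swap mulrDl !mulrDr.
by rewrite [RHS](AC ((2*2)*(1*2)) ((1*5*4)*(3*6)*(7*2))).
Qed.

(** Both sides stay doubled because 2 need not be cancellable in the ring [A]. *)
Lemma bracket_sum_pair_sum m :
  bracket (\sum_(i < m.+1) t i) (\sum_(i < m.+1) t i * t i) = 0 ->
  bracket (\sum_(i < m.+1) t i) (pair_sum m.+1) *+ 2
  = (\sum_(i < m.-1) (t i.+2 * t i * t i.+1 - t i.+1 * t i * t i.+2)) *+ 2.
Proof.
move=> sqr0; rewrite -bracket_sum_adjacent_sum -bracketMnr.
have := congr1 (bracket (\sum_(i < m.+1) t i)) (double_pair_sum m).
by rewrite !bracketDr sqr0 addr0 bracketMr bracketxx mul0r mulr0 !add0r.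
Qed.

End BraidSums.

(** * Commutators under a quadratic relation *)

Section BracketAlgebra.
Variables (K : fieldType) (A : algType K).
Implicit Types x y : A.

Lemma bracket_scaler x y k :
  bracket x (k *: y) = k *: bracket x y.
Proof. by rewrite /bracket -scalerAr -scalerAl scalerBr. Qed.

Lemma bracket_algr x k : bracket x k%:A = 0.
Proof. by rewrite bracket_scaler /bracket mulr1 mul1r subrr scaler0. Qed.

(** For u = x or y and v the other one, [u, uv + vu] = [u^2, v] = c [u, v], and [x, y] + [y, x] = 0.
    This is the source of [t_near]. *)
Lemma bracket_quadratic x y c d :
  x * x = c *: x + d%:A -> y * y = c *: y + d%:A ->
  bracket x (x * y + y * x) + bracket y (x * y + y * x) = 0.
Proof.
have sqr_comm (u v : A) : u * u = c *: u + d%:A ->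
    bracket u (u * v + v * u) = c *: bracket u v.
  move=> uu; rewrite bracketDr !bracketMr bracketxx mul0r mulr0 add0r addr0.
  rewrite [bracket u v]/bracket mulrBl mulrBr !mulrA addrA subrK -(mulrA v) uu.
  rewrite mulrDl mulrDr -!scalerAl -!scalerAr mul1r mulr1 opprD addrACA.
  by rewrite subrr addr0 scalerBr.
move=> xx yy; rewrite [X in bracket y X]addrC !sqr_comm // -scalerDr /bracket.
by rewrite subrKA subrr scaler0.
Qed.

End BracketAlgebra.

(** * The sums over lengths 1 and 2 in the Hecke algebra *)

Section HeckeSums.
Variables (K : fieldType) (q : K) (n : nat).
Local Notation s := (@simple_transp n).
Local Notation g := (@hecke_gen K q n).
Local Notation t := (fun i : nat => hecke_T q n i.+1).

Lemma hecke_Tw_simple i : hecke_Tw q (s i) = g i.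
Proof.
move: (reduced_word_size (s i)) (prod_reduced_word (s i)).
rewrite coxeter_length_simple /hecke_Tw.
by case: reduced_word => [|k []] // _; rewrite !big_seq1 => /simple_transp_inj ->.
Qed.

Lemma hecke_gen_commute (i j : 'I_n.-1) :
  (i.+1 < j)%N || (j.+1 < i)%N -> g i * g j = g j * g i.
Proof. by have [_ + _] := hecke_gen_relations q n; apply. Qed.

(** The chosen reduced word is either [i], [j] or, for distant indices only, [j], [i]; in the latter
    case the generators commute. *)
Lemma hecke_Tw_simple_mul i j : i != j -> hecke_Tw q (s i * s j)%g = g i * g j.
Proof.
move=> ij.
have [k [l [_ eqw wE]]] := reduced_word_length2 (coxeter_length_simple_mul ij).
rewrite /hecke_Tw wE big_cons big_seq1.
have [[-> ->] // | [[-> ->] far]] := simple_mul_eq ij eqw.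
exact/esym/hecke_gen_commute.
Qed.

Lemma hecke_Y1 : hecke_Y q n 1 = \sum_i g i.
Proof.
rewrite /hecke_Y; transitivity (\sum_(w in s @: [set: 'I_n.-1]) hecke_Tw q w).
  apply: eq_bigl => w; apply/coxeter_length1P/imsetP => [[i ->]|[i _ ->]].
    by exists i.
  by exists i.
rewrite big_imset; last by move=> i j _ _; apply: simple_transp_inj.
by apply: eq_big => [i|i _]; rewrite ?inE ?hecke_Tw_simple.
Qed.

Lemma hecke_Y2 :
  hecke_Y q n 2 =
  \sum_(j < n.-1) \sum_(i < n.-1 | (i < j)%N || (i == j.+1 :> nat)) g i * g j.
Proof.
pose D := [set p : 'I_n.-1 * 'I_n.-1 | (p.2 < p.1)%N || (p.2 == p.1.+1 :> nat)].
pose h (p : 'I_n.-1 * 'I_n.-1) : 'S_n := (s p.2 * s p.1)%g.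
have D_neq p : p \in D -> p.2 != p.1 by rewrite inE -val_eqE /=; lia.
rewrite pair_big_dep /hecke_Y; transitivity (\sum_(w in h @: D) hecke_Tw q w).
  apply: eq_bigl => w; apply/eqP/imsetP => [|[p /D_neq ne ->]]; last first.
    exact: coxeter_length_simple_mul.
  case/reduced_word_length2 => [i [j [ij -> _]]].
  have [ltij|leji] := ltnP i j; first by exists (j, i); rewrite ?inE ?ltij.
  have [eqi|nei] := eqVneq (i : nat) j.+1.
    by exists (j, i); rewrite // inE /= eqi eqxx orbT.
  have ne : i != j :> nat by [].
  have lt : (j.+1 < i)%N by lia.
  (* For [i] above [j.+1] the product is represented in [D] by its reversed, increasing form. *)
  exists (i, j); first by rewrite inE /= ltnW.
  by rewrite /h simple_transp_commute // lt orbT.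
rewrite big_imset => [|[j i] [l k] /= Dji Dlk /(simple_mul_eq (D_neq _ Dji))].
  apply: eq_big => [p|p /D_neq]; first by rewrite inE.
  exact: hecke_Tw_simple_mul.
(* In the second case the indices are distant and both of their orders would lie in [D], which is
   impossible. *)
case=> /= [[-> ->] // | [[kj li] far]].
by move: Dji Dlk; rewrite !inE /= kj li; lia.
Qed.

Lemma hecke_T_gen (i : 'I_n.-1) : t i = g i.
Proof.
rewrite /hecke_T; case: pickP => [j|/(_ i)]; last by rewrite eqxx.
by rewrite eqSS => /eqP/val_inj ->.
Qed.

(** The value 0 beyond the range makes the distant and adjacent commutator relations hold for all
    natural indices, as [t_far] and [t_near] demand. *)
Lemma hecke_T_out i : (n.-1 <= i)%N -> t i = 0.
Proof.
move=> ni; rewrite /hecke_T; case: pickP => // j; rewrite eqSS => /eqP ji.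
by move: (ltn_ord j); rewrite ji ltnNge ni.
Qed.

Lemma hecke_T_far i j : (i.+1 < j)%N -> bracket (t i) (t j) = 0.
Proof.
move=> ij; have [jn|/hecke_T_out ->] := ltnP j n.-1; last exact: bracket0.
have i_n : (i < n.-1)%N by lia.
have /= -> := hecke_T_gen (Ordinal i_n); have /= -> := hecke_T_gen (Ordinal jn).
by rewrite /bracket hecke_gen_commute ?subrr //= ij.
Qed.

Lemma hecke_T_sqr i : (i < n.-1)%N -> t i * t i = (q - 1) *: t i + q%:A.
Proof.
move=> i_n; have /= -> := hecke_T_gen (Ordinal i_n).
by have [sqr _ _] := hecke_gen_relations q n; exact: sqr.
Qed.

Lemma hecke_T_near i :
  bracket (t i) (adjacent_sum t i) + bracket (t i.+1) (adjacent_sum t i) = 0.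
Proof.
rewrite /adjacent_sum; have [i_n|/hecke_T_out ->] := ltnP i.+1 n.-1; last first.
  by rewrite mulr0 mul0r !addr0 !bracket0 addr0.
exact: bracket_quadratic (hecke_T_sqr (ltnW i_n)) (hecke_T_sqr i_n).
Qed.

Lemma double_bracket_hecke_Y :
  bracket (hecke_Y q n 1) (hecke_Y q n 2) *+ 2 =
  (\sum_(1 <= i < n - 2)
    (hecke_T q n (i + 2) * hecke_T q n i * hecke_T q n (i + 1)
     - hecke_T q n (i + 1) * hecke_T q n i * hecke_T q n (i + 2))) *+ 2.
Proof.
rewrite hecke_Y1 hecke_Y2.
have -> : \sum_i g i = \sum_(i < n.-1) t i.
  by apply: eq_bigr => i _; rewrite hecke_T_gen.
have -> : \sum_(j < n.-1) \sum_(i < n.-1 | (i < j)%N || (i == j.+1 :> nat)) g i * g j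
    = pair_sum t n.-1.
  by apply: eq_bigr => j _; apply: eq_bigr => i _; rewrite !hecke_T_gen.
rewrite big_add1 big_mkord.
have -> : (n - 2).-1 = n.-1.-1.-1 by lia.
(* By the quadratic relation the sum of squares is [q - 1] times the sum of the generators plus a
   scalar. *)
have : bracket (\sum_(i < n.-1) t i) (\sum_(i < n.-1) t i * t i) = 0.
  have -> : \sum_(i < n.-1) t i * t i
      = (q - 1) *: (\sum_(i < n.-1) t i) + \sum_(i < n.-1) q%:A.
    rewrite scaler_sumr -big_split; apply: eq_bigr => i _.
    exact: hecke_T_sqr.
  rewrite bracketDr bracket_scaler bracketxx scaler0 add0r.
  by apply: bracket_sumr => i _; apply: bracket_algr.
case: n.-1 => [|m] sqr0.
  by rewrite !big_ord0 /bracket mul0r mulr0 subrr.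
apply: etrans (bracket_sum_pair_sum hecke_T_far hecke_T_near sqr0) _.
move: (hecke_T q n); move: (hecke q n) => A T.
by congr (_ *+ 2); apply: eq_bigr => i _; rewrite !addn1 !addn2.
Qed.

End HeckeSums.

(** * Universal properties of the quotient and of the Hecke algebra *)

(** The kernel of [F] is a two-sided ideal containing [X], so [F] is constant on classes and may be
    evaluated on representatives. *)
Lemma quot_alg_lift (K : fieldType) (A B : algType K) (X : A -> Prop)
    (properX : 1 \notin generated_ideal X) (F : {rmorphism A -> B}) :
  (forall r, X r -> F r = 0) ->
  exists f : {rmorphism quot_alg properX -> B},
    forall u, f (quot_proj properX u) = F u.
Proof.
move=> FX; have Fideal u v : quot_proj properX u = quot_proj properX v -> F u = F v.
  move/quot_projP/generated_idealP => uv; apply/eqP.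
  rewrite -subr_eq0 -rmorphB; apply/eqP; apply: (uv (fun y => F y = 0)) => //.
  split=> [|y z Fy Fz|y z Fz|y z Fy].
  - by rewrite rmorph0.
  - by rewrite rmorphB Fy Fz subrr.
  - by rewrite rmorphM Fz mulr0.
  - by rewrite rmorphM Fy mul0r.
have projK (a : quot_alg properX) : quot_proj properX (repr a) = a by exact: reprK.
pose f (a : quot_alg properX) := F (repr a).
have fB : zmod_morphism f.
  by move=> a b; rewrite /f -rmorphB; apply: Fideal; rewrite rmorphB /= !projK.
have fM : monoid_morphism f.
  split=> [|a b]; rewrite /f.
    by rewrite -(rmorph1 F); apply: Fideal; rewrite rmorph1 projK.
  by rewrite -rmorphM; apply: Fideal; rewrite rmorphM /= !projK.
pose fBM := GRing.isZmodMorphism.Build _ _ f fB.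
pose fMM := GRing.isMonoidMorphism.Build _ _ f fM.
pose fR : {rmorphism _ -> _} := HB.pack f fBM fMM.
by exists fR => u; apply: Fideal; rewrite projK.
Qed.

Lemma hecke_relator_eq0 (K : fieldType) (q : K) (n : nat) (A B : algType K)
    (f : {lrmorphism A -> B}) (x : 'I_n.-1 -> A) (y : 'I_n.-1 -> B) :
  (forall i, f (x i) = y i) ->
  (forall i, y i * y i = (q - 1) *: y i + q%:A) ->
  (forall i j : 'I_n.-1, (i.+1 < j)%N || (j.+1 < i)%N -> y i * y j = y j * y i) ->
  (forall i j : 'I_n.-1, j = i.+1 :> nat -> y i * y j * y i = y j * y i * y j) ->
  forall r, hecke_relator q x r -> f r = 0.
Proof.
move=> fx quadratic far braid _ [i|i j ij|i j ij].
- have fZ k u : f (k *: u) = k *: f u by rewrite linearZ.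
  by rewrite rmorphB rmorphM rmorphD /= !fZ rmorph1 !fx quadratic subrr.
- by rewrite rmorphB !rmorphM /= !fx far // subrr.
- by rewrite rmorphB !rmorphM /= !fx braid // subrr.
Qed.

Lemma hecke_lift (K : fieldType) (q : K) (n : nat) (B : algType K)
    (y : 'I_n.-1 -> B) :
  (forall i, y i * y i = (q - 1) *: y i + q%:A) ->
  (forall i j : 'I_n.-1, (i.+1 < j)%N || (j.+1 < i)%N -> y i * y j = y j * y i) ->
  (forall i j : 'I_n.-1, j = i.+1 :> nat -> y i * y j * y i = y j * y i * y j) ->
  exists f : {rmorphism hecke q n -> B}, forall i, f (hecke_gen q i) = y i.
Proof.
move=> quadratic far braid.
have Fgen i : free_lift y (free_gen K i) = y i by exact: free_lift_gen.
have FX := hecke_relator_eq0 Fgen quadratic far braid.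
have [f fE] := quot_alg_lift (hecke_ideal_proper q n) FX.
by exists f => i; rewrite -Fgen; apply: fE.
Qed.

(** * The reduced Burau representation *)

Section Burau.
Variables (K : fieldType) (q : K) (m : nat).
Implicit Types (i j k l : 'I_m.+1) (v : 'rV[K]_m.+1).

(** Row [i] of N, where [burau i] is [q] times the identity plus N and N vanishes outside row [i].
    The diagonal entry of [burau i] there is thus -1. *)
Definition burau_coef (i l : nat) : K :=
  if l == i then - (q + 1) else
  if l == i.+1 then 1 else if i == l.+1 then q else 0.

(* The reduced Burau representation, acting on row vectors. *)
Definition burau i : 'M[K]_m.+1 :=
  \matrix_(k, l) (q *+ (k == l) + burau_coef i l *+ (k == i)).

(** Applied repeatedly, this turns the Hecke relations into polynomial identities in the
    coefficients. *)
Lemma mul_burau v i l : (v *m burau i) 0 l = q * v 0 l + v 0 i * burau_coef i l.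
Proof.
rewrite mxE; under eq_bigr do rewrite mxE mulrDr !mulrnAr !mulrb.
rewrite big_split; congr (_ + _).
  by rewrite -big_mkcond big_pred1_eq mulrC.
by rewrite -big_mkcond big_pred1_eq.
Qed.

Lemma eq_mulmx_rV (A B : 'M[K]_m.+1) : (forall v, v *m A = v *m B) -> A = B.
Proof. by move=> AB; apply/row_matrixP => i; rewrite !rowE. Qed.

(** The coefficient at [(i, i)] is -(q + 1), which amounts to ([burau i] - q)([burau i] + 1) = 0. *)
Lemma burau_quadratic i : burau i * burau i = (q - 1) *: burau i + q%:A.
Proof.
apply: eq_mulmx_rV => v; apply/rowP => l.
rewrite mulmxDr mulmxA -scalemxAr -scalemxAr mulmx1 [RHS]mxE [X in X + _]mxE.
rewrite [X in _ = _ + X]mxE.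
rewrite !mul_burau /burau_coef eqxx; ring.
Qed.

Lemma burau_far i j : (i.+1 < j)%N || (j.+1 < i)%N ->
  burau i * burau j = burau j * burau i.
Proof.
move=> ij; apply: eq_mulmx_rV => v; apply/rowP => l.
rewrite !mulmxA !mul_burau.
have [-> ->] : burau_coef i j = 0 /\ burau_coef j i = 0.
  by rewrite /burau_coef; split; do 3!(case: eqP => [|_]; first lia).
by ring.
Qed.

(** Rests on the two mixed coefficients having product [q] and on both diagonal ones being -(q +
    1). *)
Lemma burau_braid i j : j = i.+1 :> nat ->
  burau i * burau j * burau i = burau j * burau i * burau j.
Proof.
move=> ij; apply: eq_mulmx_rV => v; apply/rowP => l.
rewrite !mulmxA !mul_burau.
have -> : burau_coef i j = 1 by rewrite /burau_coef ij eqxx gtn_eqF.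
have -> : burau_coef j i = q.
  by rewrite /burau_coef ij eqxx ltn_eqF // ltn_eqF // ltnW.
have -> : burau_coef i i = - (q + 1) by rewrite /burau_coef eqxx.
have -> : burau_coef j j = - (q + 1) by rewrite /burau_coef eqxx.
by ring.
Qed.

Local Notation e0 := (delta_mx 0 0 : 'rV[K]_m.+1).

Lemma e0_mul_burau i : i != 0 -> e0 *m burau i = q *: e0.
Proof.
move=> i0; apply/rowP => l.
by rewrite mul_burau [RHS]mxE [X in _ + X * _]mxE eqxx (negPf i0) mul0r addr0.
Qed.

(** In each product the first factor only scales [e0] by [q]. Then [e0 *m burau i] begins with -1,
    1, 0; its first entry becomes 0 under [burau j] and -q under [burau k], so the difference is q(0
    + q). *)
Lemma e0_mul_burau_commutator i j k :
  i = 0 :> nat -> j = 1 :> nat -> k = 2 :> nat ->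
  (e0 *m (burau k * burau i * burau j - burau j * burau i * burau k)) 0 0 = q ^+ 2.
Proof.
move=> i0 j1 k2; rewrite mulmxBr [LHS]mxE [X in _ + X]mxE !mulmxA.
have j_neq0 : j != 0 by rewrite -val_eqE /= j1.
have k_neq0 : k != 0 by rewrite -val_eqE /= k2.
rewrite !(e0_mul_burau j_neq0, e0_mul_burau k_neq0).
have scaleE a (v : 'rV[K]_m.+1) : (a *: v) 0 0 = a * v 0 0 by rewrite mxE.
rewrite -!scalemxAl !scaleE !mul_burau.
have -> : i = 0 by apply: val_inj.
by rewrite !mxE (negPf j_neq0) (negPf k_neq0) /burau_coef j1 k2 /=; ring.
Qed.

End Burau.

(** * Nonvanishing of the commutator *)

Lemma commutator_sum_neq0 (K : fieldType) (q : K) m (A : nzRingType)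
    (f : {rmorphism A -> 'M[K]_m.+3}) (T : nat -> A) :
  q != 0 -> (forall i, (i < m.+3)%N -> f (T i.+1) = burau q (inord i)) ->
  \sum_(1 <= i < m.+4 - 2)
    (T (i + 2)%N * T i * T (i + 1)%N - T (i + 1)%N * T i * T (i + 2)%N) != 0.
Proof.
move=> q0 fT; apply/eqP => sum0.
pose b i := burau q (inord i : 'I_m.+3).
have f_term i : (i < m.+1)%N ->
    f (T (i.+1 + 2)%N * T i.+1 * T (i.+1 + 1)%N
       - T (i.+1 + 1)%N * T i.+1 * T (i.+1 + 2)%N)
    = b i.+2 * b i * b i.+1 - b i.+1 * b i * b i.+2.
  move=> im; rewrite rmorphB !rmorphM !addn1 !addn2 !fT //; lia.
have := congr1 f sum0; rewrite rmorph0 rmorph_sum big_add1 big_mkord.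
under eq_bigr => i _ do rewrite f_term //.
move/(congr1 (fun M : 'M_m.+3 => ((delta_mx 0 0 : 'rV_m.+3) *m M) 0 0)).
rewrite mulmx0 big_ord_recl mulmxDr mulmx_sumr big1 => [|i _].
  rewrite addr0 [RHS]mxE e0_mul_burau_commutator ?inordK // => /eqP.
  by rewrite expf_eq0 (negPf q0).
have b_e0 j : (0 < j < m.+3)%N ->
    (delta_mx 0 0 : 'rV_m.+3) *m b j = q *: delta_mx 0 0.
  by case/andP=> j0 jm; rewrite e0_mul_burau // -val_eqE /= inordK // -lt0n.
(* Past the first summand all three indices are positive, so both products scale the row vector by
   [q ^+ 3]. *)
have im := ltn_ord i; rewrite lift0 mulmxBr !mulmxA.
by rewrite !(b_e0, =^~ scalemxAl) ?subrr //=; lia.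
Qed.

Lemma hecke_commutator_sum_neq0 (K : fieldType) (q : K) n : q != 0 -> (4 <= n)%N ->
  \sum_(1 <= i < n - 2)
    (hecke_T q n (i + 2) * hecke_T q n i * hecke_T q n (i + 1)
     - hecke_T q n (i + 1) * hecke_T q n i * hecke_T q n (i + 2)) != 0.
Proof.
case: n => [|[|[|[|m]]]] // q0 _.
have [f fgen] := @hecke_lift K q m.+4 _ (@burau K q m.+2)
  (@burau_quadratic _ _ _) (@burau_far _ _ _) (@burau_braid _ _ _).
apply: (commutator_sum_neq0 (f := f) q0) => i im.
have := hecke_T_gen q (inord i : 'I_(m.+4).-1).
by rewrite inordK // => ->; apply: fgen.
Qed.

(** * Cancelling the factor 2 in characteristic zero, and conclusion *)

Lemma ratfun_natr_eq0 (R : realType) k : (k%:R == 0 :> ratfun R) = (k == 0%N).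
Proof.
rewrite -(rmorph_nat (@tofrac _)) tofrac_eq0 -(rmorph_nat polyC) polyC_eq0.
exact: Num.Theory.pnatr_eq0.
Qed.

Lemma mulr2n_inj (K : fieldType) (V : lmodType K) :
  2%:R != 0 :> K -> injective (fun x : V => x *+ 2).
Proof. by move=> two_neq0 x y /=; rewrite -!scaler_nat => /(scalerI two_neq0). Qed.

Theorem proposition3p2 (R : realType) (n : nat) (hn : (4 <= n)%N) :
  let Y : nat -> hecke (qvar R) n := hecke_Y (qvar R) n in
  let T : nat -> hecke (qvar R) n := hecke_T (qvar R) n in
  Y 1%N * Y 2%N - Y 2%N * Y 1%N =
    \sum_(1 <= i < n - 2)
      (T (i + 2)%N * T i * T (i + 1)%N - T (i + 1)%N * T i * T (i + 2)%N)
  /\ Y 1%N * Y 2%N <> Y 2%N * Y 1%N.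
Proof.
move=> Y T; have two_neq0 : 2%:R != 0 :> ratfun R by rewrite ratfun_natr_eq0.
have eqYT := mulr2n_inj two_neq0 (double_bracket_hecke_Y (qvar R) n).
split; first exact: eqYT.
move=> YC; have q_neq0 : qvar R != 0 by rewrite tofrac_eq0 polyX_eq0.
apply/negP: (hecke_commutator_sum_neq0 q_neq0 hn); rewrite negbK -eqYT.
by apply/eqP; move/eqP: YC; rewrite -subr_eq0 => /eqP.
Qed.
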